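(* Let $\mathcal{Q}\subset\mathbb{R}^n$ be compact and let $(\mathcal{E},\mathcal{D})$ be a compression code for $\mathcal{Q}$ operating at rate $r$ and distortion $\delta$, with codebook $\mathcal{C}$. Let $\eta>1$, $d=\frac{\eta r}{\log_2\frac1{{\rm e}\delta}}$, and suppose $\frac{\eta}{\log\frac1{{\rm e}\delta}}\le\epsilon'$ for some $\epsilon'>0$. Let $\beta=\sqrt{\log_2(1/({\rm e}\delta))}$. Let $A\in\mathbb{R}^{d\times n}$ have i.i.d. $\mathcal{N}(0,1)$ entries and let ${\bf z}\sim\mathcal{N}(0,\sigma^2I_d)$ be independent of $A$. For ${\bf x}_o\in\mathcal{Q}$ let $\hat{{\bf x}}_o$ be any element of $\arg\min_{{\bf c}\in\mathcal{C}}\|{\bf y}_o-A{\bf c}\|_2^2$ with ${\bf y}_o=A{\bf x}_o+{\bf z}$. Then for every ${\bf x}_o\in\mathcal{Q}$, \[ \|\hat{{\bf x}}_o-{\bf x}_o\|_2\le\frac{1}{({\rm e}\delta)^{(1+\epsilon')/\eta}}\Big(\frac{2\sigma\beta}{\sqrt\eta}+\sqrt{\frac{4\sigma^2\beta^2}{\eta}+2\delta^2+\frac{4\sigma\delta}{\sqrt\eta}}\Big) \] with probability exceeding \[ 1-2{\rm e}^{-\frac{0.15\eta r}{\log_2\frac1{{\rm e}\delta}}}-{\rm e}^{-\frac{r}{\log_2\frac1{{\rm e}\delta}}}-{\rm e}^{-0.3r}-{\rm e}^{-0.3\epsilon' r}. \]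
   Context: A compression code $(\mathcal{E},\mathcal{D})$ for $\mathcal{Q}$ at rate $r$ consists of an encoder $\mathcal{E}:\mathcal{Q}\to\{1,2,\dots,2^r\}$ and a decoder $\mathcal{D}:\{1,\dots,2^r\}\to\mathbb{R}^n$; its codebook is $\mathcal{C}=\{\mathcal{D}(\mathcal{E}({\bf x})):{\bf x}\in\mathcal{Q}\}$, and its distortion is $\delta=\sup_{{\bf x}\in\mathcal{Q}}\|{\bf x}-\mathcal{D}(\mathcal{E}({\bf x}))\|_2$. $\log$ is the natural logarithm, $\log_2$ the base-2 logarithm. The probability is over $A$ and ${\bf z}$. *)

(* Defs.v *)
From HB Require Import structures.
From mathcomp Require Import all_boot all_order all_algebra.
From mathcomp Require Import all_classical all_reals all_analysis.
Set Implicit Arguments. Unset Strict Implicit. Unset Printing Implicit Defensive.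
Import Order.TTheory GRing.Theory Num.Theory.
Import numFieldNormedType.Exports.
Local Open Scope classical_set_scope.
Local Open Scope ring_scope.

Definition norm2 {R : realType} {n : nat} (v : 'cV[R]_n) : R :=
  Num.sqrt (\sum_(i < n) (v i ord0) ^+ 2).

Definition log2 {R : realType} (x : R) : R := ln x / ln 2.

Definition gauss_law {R : realType} (s : R) : set R -> \bar R :=
  fun B => if s == 0 then \d_(0:R) B else normal_prob 0 s B.

Definition has_gauss_law {R : realType} {d : measure_display} {T : measurableType d}
  (P : probability T R) (s : R) (X : T -> R) : Prop :=
  measurable_fun setT X /\
  forall B : set R, measurable B -> P (X @^-1` B) = gauss_law s B.

Definition mutually_independent {R : realType} {d : measure_display}
  {T : measurableType d} {I : finType}
  (P : probability T R) (X : I -> T -> R) : Prop :=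
  forall (J : {set I}) (B : I -> set R), (forall i, measurable (B i)) ->
    P [set w | forall i, i \in J -> B i (X i w)] =
    (\prod_(i in J) P (X i @^-1` B i))%E.

Definition codebook {R : realType} {n r : nat} (Q : set 'cV[R]_n)
  (Enc : 'cV[R]_n -> 'I_(2 ^ r)) (Dec : 'I_(2 ^ r) -> 'cV[R]_n) : set 'cV[R]_n :=
  [set Dec (Enc x) | x in Q].

Definition distortion {R : realType} {n r : nat} (Q : set 'cV[R]_n)
  (Enc : 'cV[R]_n -> 'I_(2 ^ r)) (Dec : 'I_(2 ^ r) -> 'cV[R]_n) : R :=
  sup [set norm2 (x - Dec (Enc x)) | x in Q].

Definition argmin_set {R : realType} {m n : nat} (C : set 'cV[R]_n)
  (A : 'M[R]_(m, n)) (y : 'cV[R]_m) : set 'cV[R]_n :=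
  [set c | C c /\ forall c', C c' -> norm2 (y - A *m c) ^+ 2 <= norm2 (y - A *m c') ^+ 2].

(* Main.v *)
(** Write [W c] for the norm of [A (c - xo)].  Minimality of the reconstruction
[c] against the codeword [c0] of [xo] gives
[W c ^ 2 <= W c0 ^ 2 + 2 <z, A (xo - c0)> + 2 <z, A (c - xo)>].  Given [A], the
variable [<z, A v>] is centred Gaussian with standard deviation
[sigma * |A v|], so with high probability the two cross terms are at most
[sigma * sqrt (2 r / L) * W c0] and, uniformly over the [2 ^ r] codewords,
[sigma * sqrt (2 r) * W c].  Together with chi-square bounds on [W c0] from above
and on all [W c] from below this is a quadratic inequality for [W c].

No joint law is computed: to integrate out one Gaussian variable, Fubini is applied
on [T] with the sigma-algebra generated by the other variables times [R].  One
step maps [exp (l (x + v g)^2)] to a multiple of [exp (l' x^2)], hence iterating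
gives the moment generating function of [|A v|^2]. *)

Require Import Defs.
From HB Require Import structures.
From mathcomp Require Import all_boot all_order all_algebra.
From mathcomp Require Import all_classical all_reals all_analysis.
From mathcomp Require Import measurable_realfun.
From mathcomp Require Import ring lra.
Import Order.TTheory GRing.Theory Num.Theory.
Import numFieldNormedType.Exports.
Local Open Scope classical_set_scope.
Local Open Scope ring_scope.

Set Implicit Arguments.
Unset Strict Implicit.

(** * Gaussian integrals and exponential tilting *)

Lemma ge0_integral_normal_prob (R : realType) (m s : R) (f : R -> R) :
  measurable_fun setT f -> (forall x, 0 <= f x) ->
  (\int[normal_prob m s]_x (f x)%:E =
   \int[lebesgue_measure]_x (f x * normal_pdf m s x)%:E)%E.
Proof.
move=> mf f0.
have dom := normal_prob_dominates m s.
rewrite -(Radon_Nikodym_SigmaFinite.change_of_variables dom)//; last first.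
  exact/measurable_EFinP.
under [RHS]eq_integral do rewrite EFinM.
apply: ae_eq_integral => //.
- apply: emeasurable_funM; first exact/measurable_EFinP.
  exact: measurable_int (Radon_Nikodym_SigmaFinite.f_integrable dom).
- apply: emeasurable_funM; first exact/measurable_EFinP.
  by apply/measurable_EFinP; exact: measurable_normal_pdf.
(* The Radon-Nikodym derivative and [normal_pdf] have the same integral over every measurable set,
   so they agree almost everywhere. *)
- apply: ae_eqe_mul2l; apply: integral_ae_eq => //.
  + exact: Radon_Nikodym_SigmaFinite.f_integrable dom.
  + by apply/measurable_EFinP; exact: measurable_normal_pdf.
  + by move=> E _ mE; rewrite -Radon_Nikodym_SigmaFinite.f_integral.
Qed.

(** Tilting the standard Gaussian density by [exp (l (x + v s)^2)] gives, up to a factor free of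
    [s], a Gaussian density with mean [2 l x v / q] and variance [1 / q]. The unsimplified
    denominators are those of [normal_fun] at standard deviations [1] and [1 / sqrt q]. *)
Lemma complete_square (F : realFieldType) (l x v s q : F) :
  q = 1 - 2 * l * v ^+ 2 -> 0 < q ->
  l * (x + v * s) ^+ 2 + - s ^+ 2 / (1 ^+ 2 *+ 2) =
  l / q * x ^+ 2 + - (s - 2 * l * x * v / q) ^+ 2 / (q^-1 *+ 2).
Proof.
move=> qE q0; have q0' : q != 0 by rewrite gt_eqF.
have lv : l * v ^+ 2 = (1 - q) / 2 by rewrite qE; field.
transitivity (l * x ^+ 2 + 2 * l * x * v * s + (l * v ^+ 2) * s ^+ 2 - s ^+ 2 / 2).
  by rewrite expr1n; field.
transitivity (l / q * x ^+ 2 - 2 * l * (l * v ^+ 2) * x ^+ 2 / q - q * s ^+ 2 / 2 + 2 * l * x * v * s); last first.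
  by rewrite -mulr_natr; field.
by rewrite lv; field.
Qed.

Lemma integral_exp_sqr_normal (R : realType) (l x v : R) :
  0 < 1 - 2 * l * v ^+ 2 ->
  (\int[normal_prob 0 1]_s (expR (l * (x + v * s) ^+ 2))%:E =
   ((Num.sqrt (1 - 2 * l * v ^+ 2))^-1 *
     expR (l / (1 - 2 * l * v ^+ 2) * x ^+ 2))%:E)%E.
Proof.
set q := 1 - _ => q0.
rewrite ge0_integral_normal_prob; last 2 first.
- apply: measurableT_comp; first exact: measurable_expR.
  apply: measurable_funM => //; apply: measurable_funX.
  by apply: measurable_funD => //; exact: measurable_funM.
- by move=> s; exact: expR_ge0.
have sq0 : 0 < Num.sqrt q by rewrite sqrtr_gt0.
(* The integrand is [c] times the density with mean [m] and standard deviation [1 / sqrt q]; the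
   factor [1 / sqrt q] in [c] is the ratio of the two normalising constants. *)
pose c := (Num.sqrt q)^-1 * expR (l / q * x ^+ 2).
pose m := 2 * l * x * v / q.
have -> : (fun s => (expR (l * (x + v * s) ^+ 2) * normal_pdf 0 1 s)%:E) =
   (fun s => c%:E * (normal_pdf m (Num.sqrt q)^-1 s)%:E)%E.
  apply/funext => s; rewrite -EFinM; congr EFin.
  rewrite !normal_pdfE ?oner_eq0 ?invr_eq0 ?gt_eqF//.
  rewrite /normal_fun /normal_peak exprVn sqr_sqrtr ?ltW//.
  have -> : q^-1 * pi *+ 2 = q^-1 * (1 ^+ 2 * pi *+ 2) by rewrite expr1n mul1r -mulrnAr.
  rewrite sqrtrM ?invr_ge0 ?ltW// sqrtrV ?ltW// invfM invrK /c.
  set p := (Num.sqrt (_ *+ 2))^-1.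
  rewrite mulrCA -expRD mulrACA.
  rewrite mulKf ?gt_eqF// -expRD; congr (_ * expR _).
  rewrite subr0 /m; exact: complete_square.
rewrite ge0_integralZl//=.
- by rewrite integral_normal_pdf mule1.
- by apply/measurable_EFinP; exact: measurable_normal_pdf.
- by move=> s _; rewrite lee_fin normal_pdf_ge0.
- by rewrite lee_fin mulr_ge0 ?invr_ge0 ?sqrtr_ge0 ?expR_ge0.
Qed.

Lemma integral_expM_normal (R : realType) (b s : R) : s != 0 ->
  (\int[normal_prob 0 s]_x (expR (b * x))%:E =
   (expR (s ^+ 2 / 2 * b ^+ 2))%:E)%E.
Proof.
move=> s0; rewrite ge0_integral_normal_prob; last 2 first.
- by apply: measurableT_comp; [exact: measurable_expR|exact: measurable_funM].
- by move=> x; exact: expR_ge0.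
pose c := expR (s ^+ 2 / 2 * b ^+ 2).
(* A linear tilt only moves the mean, from [0] to [s^2 b]. *)
have -> : (fun x => (expR (b * x) * normal_pdf 0 s x)%:E) =
   (fun x => c%:E * (normal_pdf (s ^+ 2 * b) s x)%:E)%E.
  apply/funext => x; rewrite -EFinM; congr EFin.
  rewrite !normal_pdfE // /normal_fun mulrCA [RHS]mulrCA -!expRD.
  by congr (_ * expR _); rewrite -mulr_natr; field.
rewrite ge0_integralZl//=.
- by rewrite integral_normal_pdf mule1.
- by apply/measurable_EFinP; exact: measurable_normal_pdf.
- by move=> x _; rewrite lee_fin normal_pdf_ge0.
- by rewrite lee_fin expR_ge0.
Qed.

(** * Integrating out one variable independent of the others *)

Section freezing.
Context {R : realType} {d : measure_display} {T : measurableType d}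
  (P : probability T R) {I : finType} (X : I -> T -> R).

Definition rectangles (J : {set I}) : set (set T) :=
  [set A | exists2 B : I -> set R, (forall i, measurable (B i)) &
    A = [set w | forall i, i \in J -> B i (X i w)]].

(** The carrier is still [T], with the coarser sigma-algebra generated by the [X i] for [i] in [J].
    Measurability on it expresses dependence on these variables alone. *)
Definition sigma_of (J : {set I}) := g_sigma_algebraType (rectangles J).

Lemma rectangles_setI (J : {set I}) : setI_closed (rectangles J).
Proof.
move=> _ _ [B mB ->] [C mC ->]; exists (fun i => B i `&` C i).
  by move=> i; exact: measurableI.
apply/seteqP; split => w /=.
  by move=> [h1 h2] i iJ; split; [exact: h1|exact: h2].
by move=> h; split=> i iJ; have [] := h i iJ.
Qed.

Lemma sigma_of_measurable_fun (J : {set I}) (i : I) : i \in J ->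
  measurable_fun (setT : set (sigma_of J)) (X i).
Proof.
move=> iJ _ B mB; rewrite setTI; apply: sub_sigma_algebra.
exists (fun k => if k == i then B else setT); first by move=> k; case: ifP.
apply/seteqP; split => w /=.
  by move=> Bw k kJ; case: eqP => // ->.
by move=> /(_ i iJ); rewrite eqxx.
Qed.

Lemma sigma_of_subset (J K : {set I}) d' (U : measurableType d') (f : T -> U) :
  J \subset K ->
  measurable_fun (setT : set (sigma_of J)) f ->
  measurable_fun (setT : set (sigma_of K)) f.
Proof.
move=> JK mf _ B mB; have {mf mB} := mf measurableT B mB.
rewrite !setTI; apply: smallest_sub; first exact: smallest_sigma_algebra.
move=> _ [C mC ->]; apply: sub_sigma_algebra.
(* Leaving the coordinates outside [J] unconstrained makes a [J]-rectangle a [K]-rectangle. *)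
exists (fun k => if k \in J then C k else setT); first by move=> k; case: ifP.
apply/seteqP; split => w /=.
  by move=> Cw k kJ; case: ifPn => // kJ'; exact: Cw.
by move=> Cw k kJ; have := Cw k (fintype.subsetP JK _ kJ); rewrite kJ.
Qed.

Hypothesis mX : forall i, measurable_fun setT (X i).

Lemma rectangles_measurable (J : {set I}) : rectangles J `<=` measurable.
Proof.
move=> _ [B mB ->].
apply: (@fin_bigcap_measurable _ _ _ [set` J] (fun i => X i @^-1` B i)) => //.
by move=> i _; rewrite -[X in measurable X]setTI; exact: mX.
Qed.

Lemma measurable_sigma_of (J : {set I}) (A : set T) :
  (rectangles J).-sigma.-measurable A -> measurable A.
Proof.
by apply: smallest_sub; [exact: sigma_algebra_measurable|
  exact: rectangles_measurable].
Qed.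

Lemma sigma_of_measurable_funT (J : {set I}) d' (U : measurableType d')
    (f : T -> U) :
  measurable_fun (setT : set (sigma_of J)) f -> measurable_fun setT f.
Proof.
move=> mf _ B mB; apply: (@measurable_sigma_of J).
exact: mf.
Qed.

Hypothesis indep : mutually_independent P X.

(** Uniqueness of measures on a pi-system: for fixed [B], both sides are finite measures in [A], and
    they agree on the rectangles by mutual independence. *)
Lemma sigma_of_independent (J : {set I}) (k : I) (A : set T) (B : set R) :
  k \notin J -> (rectangles J).-sigma.-measurable A -> measurable B ->
  (P (A `&` X k @^-1` B) = P A * P (X k @^-1` B))%E.
Proof.
move=> kJ sA mB.
have mXB : measurable (X k @^-1` B).
  by rewrite -[X in measurable X]setTI; exact: mX.
pose p := fine (P (X k @^-1` B)).
have p0 : 0 <= p by exact: fine_ge0.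
pose q := NngNum p0.
have pE : (p%:E = P (X k @^-1` B))%E by rewrite fineK// fin_num_measure.
pose m1 := mrestr P mXB.
pose m2 := mscale q P.
have m2E C : (m2 C = P (X k @^-1` B) * P C)%E by rewrite -pE.
suff : m1 A = m2 A by rewrite m2E muleC.
apply: (g_sigma_algebra_measure_unique (rectangles J) _ (fun=> setT)) => //.
- exact: rectangles_measurable.
- by move=> _; exists (fun=> setT) => //; apply/seteqP; split.
- by rewrite bigcup_const.
- exact: rectangles_setI.
- move=> _ [C mC ->]; rewrite [RHS]m2E.
  rewrite [LHS](_ : _ = P ([set w | forall i, i \in J -> C i (X i w)] `&`
    X k @^-1` B))//.
  (* The rectangle with the extra constraint [B] at [k] is a rectangle over [k |: J], so its
     probability splits off the factor of [k]. *)
  pose D i := if i == k then B else C i.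
  have mD i : measurable (D i) by rewrite /D; case: ifP.
  have JD i : i \in J -> D i = C i.
    by move=> iJ; rewrite /D; case: eqP => // ik; rewrite -ik iJ in kJ.
  have := @indep (k |: J) D mD; rewrite big_setU1//= {2}/D eqxx.
  under eq_bigr => i iJ do rewrite JD//.
  rewrite -(@indep J C mC) => <-; congr (P _); apply/seteqP; split => w /=.
    move=> [Cw Bw] i; rewrite !inE => /orP[/eqP->|iJ]; first by rewrite /D eqxx.
    by rewrite JD//; exact: Cw.
  move=> Dw; split.
    by move=> i iJ; rewrite -JD//; apply: Dw; rewrite !inE iJ orbT.
  by have := Dw k; rewrite /D eqxx; apply; rewrite !inE eqxx.
- by move=> _; apply: (le_lt_trans (probability_le1 _ _)); rewrite ?ltry ?setTI.
Qed.

(** The pair of the identity into [sigma_of J] and [X k] has a product law, by independence; Tonelli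
    then integrates [X k] with the rest frozen. *)
Lemma freezing (J : {set I}) (k : I) (Z : {mfun T >-> R})
    (F : sigma_of J * R -> \bar R) :
  k \notin J -> Z = X k :> (T -> R) ->
  measurable_fun setT F -> (forall x, 0 <= F x)%E ->
  (\int[P]_w F (w, X k w) =
   \int[P]_w \int[distribution P Z]_s F (w, s))%E.
Proof.
move=> kJ ZE mF F0.
have mid : measurable_fun setT (fun w : T => w : sigma_of J).
  by move=> _ A mA; rewrite setTI; exact: measurable_sigma_of mA.
pose Y : {mfun T >-> sigma_of J} := HB.pack (fun w : T => w : sigma_of J)
  (isMeasurableFun.Build _ _ _ _ _ mid).
pose YX := fun w : T => (w : sigma_of J, Z w).
have mYX : measurable_fun setT YX.
  by apply/measurable_fun_pairP; split; [exact: mid|exact: measurable_funPT].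
pose W : {mfun T >-> (sigma_of J * R)%type} := HB.pack YX
  (isMeasurableFun.Build _ _ _ _ _ mYX).
have jointE : forall A, measurable A ->
    (distribution P Y \x distribution P Z)%E A = distribution P W A.
  apply: product_measure_unique => A B mA mB /=.
  rewrite /distribution /pushforward /= [in RHS]ZE.
  rewrite -(sigma_of_independent kJ mA mB) -ZE; congr (P _).
transitivity (\int[P]_w (F \o W) w)%E.
  by apply: eq_integral => w _; rewrite /= -ZE.
rewrite -ge0_integral_distribution//.
rewrite (eq_measure_integral (distribution P Y \x distribution P Z)%E); last first.
  by move=> A mA _; exact/esym/jointE.
rewrite fubini_tonelli1// ge0_integral_distribution//.
- exact: measurable_fun_fubini_tonelli_F.
- by move=> y; exact: integral_ge0.
Qed.

End freezing.

(** * Moment generating functions by peeling off Gaussian variables *)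

Lemma measurable_sum_seq {R : realType} {d : measure_display}
    {T : measurableType d} {I : eqType} (s : seq I) (h : I -> T -> R) :
  {in s, forall i, measurable_fun setT (h i)} ->
  measurable_fun setT (fun x => \sum_(i <- s) h i x).
Proof.
elim: s => [|i s IH] hs; first by under eq_fun do rewrite big_nil; exact: measurable_cst.
under eq_fun do rewrite big_cons.
apply: measurable_funD; first by apply: hs; rewrite mem_head.
by apply: IH => j js; apply: hs; rewrite inE js orbT.
Qed.

Section gaussian_peeling.
Context {R : realType} {d : measure_display} {T : measurableType d}
  (P : probability T R).

(* [normal_prob] lives on [measurableTypeR R], whose display differs from that
   of [R]; the pushforward along the identity moves it to [R]. *)
Lemma ge0_integral_gauss_law (Z : {mfun T >-> R}) (s : R) (f : R -> R) :
  has_gauss_law P s Z -> s != 0 ->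
  measurable_fun setT f -> (forall x, 0 <= f x) ->
  (\int[distribution P Z]_x (f x)%:E = \int[normal_prob 0 s]_x (f x)%:E)%E.
Proof.
move=> [_ lawZ] s0 mf f0.
have mid : measurable_fun setT (fun x : measurableTypeR R => x : R).
  by move=> _ A mA; rewrite setTI; exact: mA.
pose V : {mfun measurableTypeR R >-> R} :=
  HB.pack (fun x : measurableTypeR R => x : R)
    (isMeasurableFun.Build _ _ _ _ _ mid).
transitivity (\int[distribution (normal_prob 0 s) V]_x (f x)%:E)%E.
  apply: eq_measure_integral => A mA _.
  by have := lawZ A mA; rewrite /gauss_law (negbTE s0).
rewrite ge0_integral_distribution//; exact/measurable_EFinP.
Qed.

Lemma integral_gauss_law_exp_sqr (Z : {mfun T >-> R}) (l x v : R) :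
  has_gauss_law P 1 Z -> 0 < 1 - 2 * l * v ^+ 2 ->
  (\int[distribution P Z]_s (expR (l * (x + v * s) ^+ 2))%:E =
   ((Num.sqrt (1 - 2 * l * v ^+ 2))^-1 *
     expR (l / (1 - 2 * l * v ^+ 2) * x ^+ 2))%:E)%E.
Proof.
move=> law q0; rewrite -integral_exp_sqr_normal//.
apply: (ge0_integral_gauss_law (f := fun s => expR (l * (x + v * s) ^+ 2))) => //.
apply: measurableT_comp; first exact: measurable_expR.
apply: measurable_funM => //; apply: measurable_funX.
by apply: measurable_funD => //; exact: measurable_funM.
Qed.

Lemma integral_gauss_law_expM (Z : {mfun T >-> R}) (s b : R) :
  has_gauss_law P s Z ->
  (\int[distribution P Z]_x (expR (b * x))%:E =
   (expR (s ^+ 2 / 2 * b ^+ 2))%:E)%E.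
Proof.
move=> law; have [s0|s0] := eqVneq s 0.
  (* Without noise the law is the Dirac mass at [0], and both sides are [1]. *)
  rewrite (eq_measure_integral (\d_(0 : R))); last first.
    by move=> A mA _; have := law.2 A mA; rewrite /gauss_law s0 eqxx.
  rewrite integral_dirac//=; last first.
    apply/measurable_EFinP; apply: measurableT_comp; first exact: measurable_expR.
    exact: measurable_funM.
  by rewrite diracT mul1e s0 mulr0 expr0n/= !mul0r.
rewrite -integral_expM_normal//.
apply: (ge0_integral_gauss_law (f := fun x => expR (b * x))) => //.
by apply: measurableT_comp; [exact: measurable_expR|exact: measurable_funM].
Qed.

Context {I : finType} (X : I -> T -> R).
Hypothesis mX : forall i, measurable_fun setT (X i).
Hypothesis indep : mutually_independent P X.

(** With [G] and [H] frozen this is the one-variable integral. The exponent keeps its quadratic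
    shape, with a new parameter in place of [l], so the step can be repeated with [H] as the sum of
    the variables still to be integrated. *)
Lemma freezing_exp_sqr (J : {set I}) (k : I) (G H : T -> R) (l v : R) :
  k \notin J -> has_gauss_law P 1 (X k) -> 0 < 1 - 2 * l * v ^+ 2 ->
  (forall w, 0 <= G w) ->
  measurable_fun (setT : set (sigma_of X J)) G ->
  measurable_fun (setT : set (sigma_of X J)) H ->
  (\int[P]_w (G w * expR (l * (H w + v * X k w) ^+ 2))%:E =
   \int[P]_w (G w * ((Num.sqrt (1 - 2 * l * v ^+ 2))^-1 *
     expR (l / (1 - 2 * l * v ^+ 2) * H w ^+ 2)))%:E)%E.
Proof.
move=> kJ law q0 G0 mG mH.
pose Z : {mfun T >-> R} := HB.pack (X k) (isMeasurableFun.Build _ _ _ _ _ (mX k)).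
pose F (p : sigma_of X J * R) :=
  (G p.1 * expR (l * (H p.1 + v * p.2) ^+ 2))%:E.
rewrite (freezing mX indep (F := F) (Z := Z) kJ)//; last 2 first.
- apply/measurable_EFinP; apply: measurable_funM.
    exact: (measurableT_comp mG measurable_fst).
  apply: measurableT_comp; first exact: measurable_expR.
  apply: measurable_funM => //; apply: measurable_funX.
  apply: measurable_funD.
    exact: (measurableT_comp mH measurable_fst).
  exact: measurable_funM.
- by move=> x; rewrite lee_fin mulr_ge0// expR_ge0.
apply: eq_integral => w _; rewrite /F/=.
under eq_integral do rewrite EFinM.
rewrite ge0_integralZl//.
- by rewrite integral_gauss_law_exp_sqr// -EFinM.
- apply/measurable_EFinP; apply: measurableT_comp; first exact: measurable_expR.
  apply: measurable_funM => //; apply: measurable_funX.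
  by apply: measurable_funD => //; exact: measurable_funM.
- by rewrite lee_fin; exact: G0.
Qed.

Lemma freezing_expM (J : {set I}) (k : I) (G b : T -> R) (s : R) :
  k \notin J -> has_gauss_law P s (X k) ->
  (forall w, 0 <= G w) ->
  measurable_fun (setT : set (sigma_of X J)) G ->
  measurable_fun (setT : set (sigma_of X J)) b ->
  (\int[P]_w (G w * expR (b w * X k w))%:E =
   \int[P]_w (G w * expR (s ^+ 2 / 2 * b w ^+ 2))%:E)%E.
Proof.
move=> kJ law G0 mG mb.
pose Z : {mfun T >-> R} := HB.pack (X k) (isMeasurableFun.Build _ _ _ _ _ (mX k)).
pose F (p : sigma_of X J * R) := (G p.1 * expR (b p.1 * p.2))%:E.
rewrite (freezing mX indep (F := F) (Z := Z) kJ)//; last 2 first.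
- apply/measurable_EFinP; apply: measurable_funM.
    exact: (measurableT_comp mG measurable_fst).
  apply: measurableT_comp; first exact: measurable_expR.
  by apply: measurable_funM => //; exact: (measurableT_comp mb measurable_fst).
- by move=> x; rewrite lee_fin mulr_ge0// expR_ge0.
apply: eq_integral => w _; rewrite /F/=.
under eq_integral do rewrite EFinM.
rewrite ge0_integralZl//.
- by rewrite (@integral_gauss_law_expM Z s)// -EFinM.
- apply/measurable_EFinP; apply: measurableT_comp; first exact: measurable_expR.
  exact: measurable_funM.
- by rewrite lee_fin; exact: G0.
Qed.

(** Induction on [ks], with the constants produced so far absorbed in the weight [G]. Peeling [k]
    replaces [l] by [l / q1], and the factors telescope: [q1 (1 - 2 (l / q1) S) = 1 - 2 l (a k ^ 2 +
    S)]. *)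
Lemma integral_exp_sqr_sum (ks : seq I) (a : I -> R) (J : {set I})
    (G : T -> R) (l : R) :
  uniq ks -> {in ks, forall k, k \notin J} ->
  (forall k, k \in ks -> has_gauss_law P 1 (X k)) ->
  0 < 1 - 2 * l * (\sum_(k <- ks) a k ^+ 2) ->
  (forall w, 0 <= G w) -> measurable_fun (setT : set (sigma_of X J)) G ->
  (\int[P]_w (G w * expR (l * (\sum_(k <- ks) a k * X k w) ^+ 2))%:E =
   \int[P]_w (G w * (Num.sqrt (1 - 2 * l * \sum_(k <- ks) a k ^+ 2))^-1)%:E)%E.
Proof.
elim: ks l G => [|k ks IH] l G.
  move=> _ _ _ _ _ _; apply: eq_integral => w _.
  by rewrite !big_nil expr0n/= !mulr0 subr0 expR0 sqrtr1 invr1.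
rewrite /= => /andP[kks uks] ksJ law; rewrite big_cons => q0 G0 mG.
set q1 := 1 - 2 * l * a k ^+ 2.
set S := \sum_(j <- ks) a j ^+ 2 in q0 *.
have S0 : 0 <= S by apply: sumr_ge0 => i _; exact: sqr_ge0.
have q10 : 0 < q1.
  (* For [l <= 0] one has [q1 >= 1]; for [l > 0], [q1] is at least the quantity assumed positive. *)
  rewrite /q1; have [l0|l0] := leP l 0.
    by have := sqr_ge0 (a k); nra.
  by have := mulr_ge0 (ltW l0) S0; nra.
pose J' := J :|: [set j in ks].
have JJ' : J \subset J' by exact: finset.subsetUl.
have kJ' : k \notin J' by rewrite !inE negb_or ksJ ?mem_head.
have mS : measurable_fun (setT : set (sigma_of X J'))
    (fun w => \sum_(j <- ks) a j * X j w).
  apply: measurable_sum_seq => j jks.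
  apply: measurable_funM => //; apply: sigma_of_measurable_fun.
  by rewrite !inE jks orbT.
under eq_integral do rewrite big_cons addrC.
rewrite (freezing_exp_sqr kJ')//; last 2 first.
- by apply: law; rewrite mem_head.
- exact: sigma_of_subset mG.
rewrite -/q1.
under eq_integral do rewrite mulrA.
rewrite IH//.
- apply: eq_integral => w _; congr EFin; rewrite -mulrA -invfM -sqrtrM ?ltW//.
  congr (_ * (Num.sqrt _)^-1); rewrite mulrBr mulr1 /q1 -/q1.
  by rewrite -/S /q1; move: q10; rewrite /q1 => q10; field; rewrite gt_eqF.
- by move=> j jks; apply: ksJ; rewrite inE jks orbT.
- by move=> j jks; apply: law; rewrite inE jks orbT.
- rewrite -/S (_ : _ - _ = (1 - 2 * l * (a k ^+ 2 + S)) / q1) ?divr_gt0//.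
  by move: q10; rewrite /q1 => q10; field; rewrite gt_eqF.
- by move=> w; rewrite mulr_ge0// invr_ge0 sqrtr_ge0.
- exact: measurable_funM.
Qed.

(** The lists in [kss] are disjoint blocks of variables. While one block is integrated out, the
    exponential of the remaining blocks serves as the weight [G]; each block contributes the same
    factor. *)
Lemma integral_exp_sum_sqr_sum (kss : seq (seq I)) (a : I -> R) (l v : R) :
  uniq (flatten kss) ->
  (forall k, k \in flatten kss -> has_gauss_law P 1 (X k)) ->
  0 < 1 - 2 * l * v ->
  (forall ks, ks \in kss -> \sum_(k <- ks) a k ^+ 2 = v) ->
  (\int[P]_w (expR (l * \sum_(ks <- kss) (\sum_(k <- ks) a k * X k w) ^+ 2))%:E =
   ((Num.sqrt (1 - 2 * l * v))^-1 ^+ size kss)%:E)%E.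
Proof.
elim: kss => [|ks kss IH] /=.
  move=> _ _ _ _; under eq_integral do rewrite big_nil mulr0 expR0.
  by rewrite integral_cst// mul1e expr0; exact: probability_setT.
rewrite cat_uniq => /and3P[uks ksn ukss] law q0 av.
pose J := [set j in flatten kss].
pose G w := expR (l * \sum_(ks <- kss) (\sum_(k <- ks) a k * X k w) ^+ 2).
have mG : measurable_fun (setT : set (sigma_of X J)) G.
  apply: measurableT_comp; first exact: measurable_expR.
  apply: measurable_funM => //.
  apply: measurable_sum_seq => r rkss.
  apply: measurable_funX.
  apply: measurable_sum_seq => j jr.
  apply: measurable_funM => //; apply: sigma_of_measurable_fun.
  by rewrite inE; apply/flattenP; exists r.
have avk : \sum_(k <- ks) a k ^+ 2 = v by apply: av; rewrite mem_head.
under eq_integral do rewrite big_cons mulrDr expRD mulrC -/(G _).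
rewrite (integral_exp_sqr_sum (J := J))//; last 4 first.
- by move=> k kks; rewrite inE; apply: contra ksn => kf; apply/hasP; exists k.
- by move=> k kks; apply: law; rewrite mem_cat kks.
- by rewrite avk.
- by move=> w; exact: expR_ge0.
rewrite avk; under eq_integral do rewrite mulrC EFinM.
rewrite ge0_integralZl//.
- rewrite IH// ?exprS//.
  + by move=> k kf; apply: law; rewrite mem_cat kf orbT.
  + by move=> r rk; apply: av; rewrite inE rk orbT.
- by apply/measurable_EFinP; exact: (sigma_of_measurable_funT mX mG).
- by move=> w _; rewrite lee_fin; exact: expR_ge0.
Qed.

(** The random coefficients [b k] depend only on the variables in [J]; given these, the sum is
    centred Gaussian with variance [s^2] times the sum of the [b k ^ 2]. *)
Lemma integral_exp_sum_expM (ks : seq I) (b : I -> T -> R) (J : {set I})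
    (G : T -> R) (s : R) :
  uniq ks -> {in ks, forall k, k \notin J} ->
  (forall k, k \in ks -> has_gauss_law P s (X k)) ->
  (forall w, 0 <= G w) -> measurable_fun (setT : set (sigma_of X J)) G ->
  (forall k, measurable_fun (setT : set (sigma_of X J)) (b k)) ->
  (\int[P]_w (G w * expR (\sum_(k <- ks) b k w * X k w))%:E =
   \int[P]_w (G w * expR (s ^+ 2 / 2 * \sum_(k <- ks) b k w ^+ 2))%:E)%E.
Proof.
elim: ks G => [|k ks IH] G.
  move=> _ _ _ _ _ _; apply: eq_integral => w _.
  by rewrite !big_nil mulr0.
rewrite /= => /andP[kks uks] ksJ law G0 mG mb.
pose J' := J :|: [set j in ks].
have JJ' : J \subset J' by exact: finset.subsetUl.
have kJ' : k \notin J' by rewrite !inE negb_or ksJ ?mem_head.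
pose G' w := G w * expR (\sum_(j <- ks) b j w * X j w).
have mG' : measurable_fun (setT : set (sigma_of X J')) G'.
  apply: measurable_funM; first exact: sigma_of_subset mG.
  apply: measurableT_comp; first exact: measurable_expR.
  apply: measurable_sum_seq => j jks.
  apply: measurable_funM; first exact: sigma_of_subset (mb j).
  by apply: sigma_of_measurable_fun; rewrite !inE jks orbT.
under eq_integral do rewrite big_cons addrC expRD mulrA -/(G' _).
rewrite (freezing_expM (J := J') (s := s))//; last 3 first.
- by apply: law; rewrite mem_head.
- by move=> w; rewrite mulr_ge0// expR_ge0.
- exact: sigma_of_subset (mb k).
(* After [X k] is gone, the factor it leaves is measurable for [sigma_of J] and joins the weight, so
   the induction hypothesis applies with the original [J]. *)
rewrite /G'; under eq_integral do rewrite mulrAC.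
rewrite IH//.
- by apply: eq_integral => w _; rewrite big_cons mulrDr expRD mulrA.
- by move=> j jks; apply: ksJ; rewrite inE jks orbT.
- by move=> j jks; apply: law; rewrite inE jks orbT.
- by move=> w; rewrite mulr_ge0// expR_ge0.
- apply: measurable_funM => //.
  apply: measurableT_comp; first exact: measurable_expR.
  by apply: measurable_funM => //; exact: measurable_funX.
Qed.

End gaussian_peeling.

(** * Numerical bounds on [ln 2] *)

Lemma expR_7_10_ge2 (R : realType) : 2 <= expR (7 / 10 : R).
Proof.
have h : (7 / 10 : R) = 2 * (2 * (2 * (2 * (2 * (2 * (7 / 640)))))) by lra.
have e2 (x : R) : expR (2 * x) = expR x ^+ 2 by rewrite mulrC -expRM_natr.
have step (a b x : R) : 0 <= a -> b <= a ^+ 2 -> a <= expR x -> b <= expR (2 * x).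
  by move=> a0 ba ax; rewrite e2 (le_trans ba)// ler_sqr// nnegrE expR_ge0.
(* the fractions are lower bounds for the iterated squares of [1 + 7/640] *)
rewrite h; apply: (@step (358 / 253)); [lra|lra|].
apply: (@step (251 / 211)); [lra|lra|].
apply: (@step (433 / 397)); [lra|lra|].
apply: (@step (47 / 45)); [lra|lra|].
apply: (@step (697 / 682)); [lra|lra|].
apply: (@step (647 / 640)); [lra|lra|].
by apply: le_trans (expR_ge1Dx _); lra.
Qed.

Lemma expR_3_5_le2 (R : realType) : expR (3 / 5 : R) <= 2.
Proof.
rewrite -[3 / 5]opprK expRN -[leRHS]invrK lef_pV2 ?posrE ?expR_gt0 ?invr_gt0//.
(* The target is now [1 / 2 <= exp (- 3 / 5)]: start from [1 - 3 / 40] and square three times,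
   rounding down. *)
have h : (- (3 / 5) : R) = 2 * (2 * (2 * (- (3 / 40)))) by lra.
have e2 (x : R) : expR (2 * x) = expR x ^+ 2 by rewrite mulrC -expRM_natr.
have step (a b x : R) : 0 <= a -> b <= a ^+ 2 -> a <= expR x -> b <= expR (2 * x).
  by move=> a0 ba ax; rewrite e2 (le_trans ba)// ler_sqr// nnegrE expR_ge0.
rewrite h; apply: (@step (73 / 100)); [lra|lra|].
apply: (@step (855 / 1000)); [lra|lra|].
apply: (@step (925 / 1000)); [lra|lra|].
by apply: le_trans (expR_ge1Dx _); lra.
Qed.

Lemma ln2_le (R : realType) : ln 2 <= 7 / 10 :> R.
Proof. by rewrite -ler_expR lnK ?posrE//; exact: expR_7_10_ge2. Qed.

Lemma ln2_ge (R : realType) : 3 / 5 <= ln 2 :> R.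
Proof. by rewrite -ler_expR lnK ?posrE//; exact: expR_3_5_le2. Qed.

(** * Union bound and Chernoff bound *)

Lemma measurable_exists {d : measure_display} {T : measurableType d}
    (K : finType) (E : K -> set T) :
  (forall k, measurable (E k)) -> measurable [set w | exists k, E k w].
Proof.
move=> mE; rewrite (_ : [set w | _] = \bigcup_(k in [set: K]) E k).
  exact: fin_bigcup_measurable.
by apply/seteqP; split => w [k]; exists k.
Qed.

Section union_and_chernoff.
Context {R : realType} {d : measure_display} {T : measurableType d}
  (P : probability T R).

Lemma probability_exists_le (K : finType) (E : K -> set T) :
  (forall k, measurable (E k)) ->
  (P [set w | exists k, E k w] <= \sum_k P (E k))%E.
Proof.
move=> mE.
have -> : [set w | exists k, E k w] = \big[setU/set0]_(k <- enum K) E k.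
  rewrite -bigcup_seq; apply/seteqP; split => w /=.
    by move=> [k Ekw]; exists k => //=; rewrite mem_enum.
  by move=> [k _ Ekw]; exists k.
rewrite -big_enum.
elim: (enum K) => [|k s IH]; first by rewrite !big_nil measure0.
rewrite !big_cons (le_trans (measureU2 _ _ _))//.
  by apply: bigsetU_measurable => j _.
exact: leeD.
Qed.

(** Chernoff's bound with parameter and threshold both absorbed in [g]: the indicator of [E] is at
    most [exp g], since [g >= 0] on [E]. *)
Lemma probability_le_integral_expR (E : set T) (g : T -> R) :
  measurable E -> measurable_fun setT g -> (forall w, E w -> 0 <= g w) ->
  (P E <= \int[P]_w (expR (g w))%:E)%E.
Proof.
move=> mE mg g0; rewrite -[X in P X]setIT -integral_indic//.
apply: ge0_le_integral => //.
- by apply/measurable_EFinP; exact: measurable_indic.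
- by apply/measurable_EFinP; exact: measurableT_comp (@measurable_expR R) mg.
- move=> w _; rewrite lee_fin indicE; case: (boolP (w \in E)) => [|_].
    by rewrite inE => Ew /=; apply: le_trans (expR_ge1Dx _); rewrite lerDl g0.
  exact: expR_ge0.
Qed.

End union_and_chernoff.

(** * Tail bounds for a Gaussian matrix and Gaussian noise *)

Definition sqnorm {R : realType} {n : nat} (v : 'cV[R]_n) : R :=
  \sum_(i < n) v i ord0 ^+ 2.

Definition dot {R : realType} {n : nat} (u v : 'cV[R]_n) : R :=
  \sum_(i < n) u i ord0 * v i ord0.

Lemma sqnorm_ge0 (R : realType) (n : nat) (v : 'cV[R]_n) : 0 <= sqnorm v.
Proof. by apply: sumr_ge0 => i _; exact: sqr_ge0. Qed.

Lemma norm2_sqr (R : realType) (n : nat) (v : 'cV[R]_n) : norm2 v ^+ 2 = sqnorm v.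
Proof. by rewrite sqr_sqrtr// sqnorm_ge0. Qed.

Lemma sqnorm_eq0 (R : realType) (n : nat) (v : 'cV[R]_n) :
  sqnorm v = 0 -> forall i, v i ord0 = 0.
Proof.
move=> /eqP; rewrite psumr_eq0 => [/allP h i|i _]; last exact: sqr_ge0.
by have := h i (mem_index_enum i); rewrite sqrf_eq0 => /eqP.
Qed.

Section gaussian_matrix.
Context {R : realType} {d : measure_display} {T : measurableType d}
  (P : probability T R) (m n : nat).
Variables (sigma : R) (a : 'I_m -> 'I_n -> T -> R) (z : 'I_m -> T -> R).
Hypothesis sigma0 : 0 <= sigma.
Hypothesis law_a : forall i j, has_gauss_law P 1 (a i j).
Hypothesis law_z : forall i, has_gauss_law P sigma (z i).

Let X (k : ('I_m * 'I_n) + 'I_m) : T -> R :=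
  match k with inl (i, j) => a i j | inr i => z i end.

Hypothesis indep : mutually_independent P X.

Let A (w : T) : 'M[R]_(m, n) := \matrix_(i < m, j < n) a i j w.
Let zv (w : T) : 'cV[R]_m := \col_(i < m) z i w.

Let mX k : measurable_fun setT (X k).
Proof. by case: k => [[i j]|i]; [case: (law_a i j)|case: (law_z i)]. Qed.

Lemma mulmx_entryE (v : 'cV[R]_n) i w :
  (A w *m v) i ord0 = \sum_j a i j w * v j ord0.
Proof. by rewrite mxE; apply: eq_bigr => j _; rewrite mxE. Qed.

Lemma measurable_mulmx_entry (v : 'cV[R]_n) i :
  measurable_fun setT (fun w => (A w *m v) i ord0).
Proof.
under eq_fun do rewrite mulmx_entryE.
apply: measurable_sum => j; apply: measurable_funM => //.
exact: (mX (inl (i, j))).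
Qed.

Lemma measurable_sqnorm_mulmx (v : 'cV[R]_n) :
  measurable_fun setT (fun w => sqnorm (A w *m v)).
Proof.
apply: measurable_sum => i; apply: measurable_funX.
exact: measurable_mulmx_entry.
Qed.

Lemma measurable_dot_mulmx (v : 'cV[R]_n) :
  measurable_fun setT (fun w => dot (zv w) (A w *m v)).
Proof.
apply: measurable_sum => i; apply: measurable_funM; last first.
  exact: measurable_mulmx_entry.
by under eq_fun do rewrite mxE; exact: (mX (inr i)).
Qed.

Lemma measurable_norm2_mulmx (v : 'cV[R]_n) :
  measurable_fun setT (fun w => norm2 (A w *m v)).
Proof.
apply: measurableT_comp; last exact: measurable_sqnorm_mulmx.
by apply: continuous_measurable_fun; exact: sqrt_continuous.
Qed.

(** The entries of [A v] are sums over disjoint rows of Gaussian variables, all with coefficient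
    vector [v]; hence the chi-square formula with [m] degrees of freedom, scaled by [|v|^2]. *)
Lemma mgf_sqnorm_mulmx (v : 'cV[R]_n) (l : R) :
  0 < 1 - 2 * l * sqnorm v ->
  (\int[P]_w (expR (l * sqnorm (A w *m v)))%:E =
   ((Num.sqrt (1 - 2 * l * sqnorm v))^-1 ^+ m)%:E)%E.
Proof.
move=> q0.
pose kss : seq (seq (('I_m * 'I_n) + 'I_m)) :=
  [seq [seq inl (i, j) | j <- enum 'I_n] | i <- enum 'I_m].
pose c (k : ('I_m * 'I_n) + 'I_m) : R :=
  match k with inl (i, j) => v j ord0 | inr _ => 0 end.
have flatE : flatten kss = [seq inl p | p <- [seq (i, j) | i <- enum 'I_m, j <- enum 'I_n]].
  rewrite map_flatten -map_comp /kss; congr flatten.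
  by apply: eq_map => i /=; rewrite -map_comp.
have szk : size kss = m by rewrite size_map size_enum_ord.
rewrite -[X in _ ^+ X]szk.
rewrite -(integral_exp_sum_sqr_sum (X := X) mX indep (kss := kss) (a := c))//.
- apply: eq_integral => w _; congr (expR (_ * _))%:E.
  rewrite big_map big_enum /=; apply: eq_bigr => i _; rewrite mulmx_entryE.
  rewrite big_map big_enum /=; congr (_ ^+ 2).
  by apply: eq_bigr => j _; rewrite mulrC.
- rewrite flatE map_inj_uniq; last by move=> x y [].
  by rewrite allpairs_uniq ?enum_uniq// => -[? ?] [? ?] _ _.
- by move=> k; rewrite flatE => /mapP[[i j] _ ->]; exact: law_a.
- move=> ks /mapP[i _ ->]; rewrite big_map big_enum /=.
  by [].
Qed.

(** Chernoff with [l = 1 / (4 delta^2)]: the generating function is at most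
    [sqrt 2 ^ m <= exp (0.35 m)] and the threshold contributes [exp (- m / 2)]. *)
Lemma sqnorm_mulmx_upper_tail (v : 'cV[R]_n) (delta : R) :
  0 < delta -> sqnorm v <= delta ^+ 2 ->
  (P [set w | (2 * m%:R * delta ^+ 2 < sqnorm (A w *m v))%R] <=
   (expR (- (15 / 100 * m%:R)))%:E)%E.
Proof.
move=> delta0 vd.
have d20 : 0 < delta ^+ 2 by rewrite exprn_gt0.
pose l := (4 * delta ^+ 2)^-1.
have l0 : 0 < l by rewrite invr_gt0 mulr_gt0.
have lv : 2^-1 <= 1 - 2 * l * sqnorm v.
  have : l * sqnorm v <= l * delta ^+ 2 by rewrite ler_pM2l.
  have -> : l * delta ^+ 2 = 4^-1 by rewrite /l; field; rewrite gt_eqF.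
  lra.
pose g w := l * sqnorm (A w *m v) - m%:R / 2.
have mg : measurable_fun setT g.
  apply: measurable_funB => //; apply: measurable_funM => //.
  exact: measurable_sqnorm_mulmx.
apply: le_trans (probability_le_integral_expR P _ mg _) _.
- rewrite -[X in measurable X]setTI.
  exact: (measurable_fun_ltr (measurable_cst _) (measurable_sqnorm_mulmx v)).
- move=> w /= h; rewrite /g subr_ge0.
  have -> : m%:R / 2 = l * (2 * m%:R * delta ^+ 2).
    by rewrite /l; field; rewrite gt_eqF.
  by rewrite ler_pM2l// ltW.
rewrite /g; under eq_integral do rewrite expRD EFinM.
rewrite ge0_integralZr//; last first.
  apply/measurable_EFinP; apply: measurableT_comp; first exact: measurable_expR.
  by apply: measurable_funM => //; exact: measurable_sqnorm_mulmx.
rewrite mgf_sqnorm_mulmx; last by lra.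
rewrite -EFinM lee_fin.
have h : (Num.sqrt (1 - 2 * l * sqnorm v))^-1 <= expR (35 / 100).
  rewrite -[leRHS]invrK lef_pV2 ?posrE ?invr_gt0 ?expR_gt0 ?sqrtr_gt0//; last by lra.
  rewrite -expRN -(ger0_norm (expR_ge0 (- (35/100)))) -sqrtr_sqr ler_wsqrtr//.
  apply: le_trans lv; rewrite -expRM_natr.
  rewrite (_ : - (35 / 100) * 2%:R = - (7 / 10)); last by lra.
  by rewrite expRN lef_pV2 ?posrE ?expR_gt0// expR_7_10_ge2.
apply: (@le_trans _ _ (expR (35 / 100) ^+ m * expR (- (m%:R / 2)))).
  by rewrite ler_pM2r ?expR_gt0// lerXn2r ?nnegrE ?invr_ge0 ?sqrtr_ge0 ?expR_ge0.
by rewrite -expRM_natr -expRD ler_expR; lra.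
Qed.

(** Chernoff with parameter [- 1 / (2 s^2 |v|^2)]: the generating function is
    [(1 + s^-2)^(- m / 2) <= s^m] and the threshold contributes [exp (m / 2)]. *)
Lemma sqnorm_mulmx_lower_tail (v : 'cV[R]_n) (s : R) :
  0 < s ->
  (P [set w | (sqnorm (A w *m v) < s ^+ 2 * m%:R * sqnorm v)%R] <=
   ((s * expR (1 / 2)) ^+ m)%:E)%E.
Proof.
move=> s0.
have [v0|v0] := eqVneq (sqnorm v) 0.
  (* For [v = 0] the strict inequality makes the event empty. *)
  rewrite (_ : [set _ | _] = set0) ?measure0; last first.
    by apply/seteqP; split => w //=; rewrite v0 mulr0 ltNge sqnorm_ge0.
  by rewrite lee_fin exprn_ge0// mulr_ge0 ?expR_ge0// ltW.
have {}v0 : 0 < sqnorm v by rewrite lt_neqAle eq_sym v0 sqnorm_ge0.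
pose l := (2 * s ^+ 2 * sqnorm v)^-1.
have l0 : 0 < l by rewrite invr_gt0 !mulr_gt0// exprn_gt0.
have lv : 1 - 2 * (- l) * sqnorm v = 1 + s ^- 2.
  by rewrite /l; field; rewrite !gt_eqF.
pose g w := - l * sqnorm (A w *m v) + m%:R / 2.
have mg : measurable_fun setT g.
  apply: measurable_funD => //; apply: measurable_funM => //.
  exact: measurable_sqnorm_mulmx.
apply: le_trans (probability_le_integral_expR P _ mg _) _.
- rewrite -[X in measurable X]setTI.
  exact: (measurable_fun_ltr (measurable_sqnorm_mulmx v) (measurable_cst _)).
- move=> w /= h; rewrite /g mulNr addrC subr_ge0.
  have -> : m%:R / 2 = l * (s ^+ 2 * m%:R * sqnorm v).
    by rewrite /l; field; rewrite !gt_eqF.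
  by rewrite ler_pM2l// ltW.
rewrite /g; under eq_integral do rewrite expRD EFinM.
rewrite ge0_integralZr//; last first.
  apply/measurable_EFinP; apply: measurableT_comp; first exact: measurable_expR.
  by apply: measurable_funM => //; exact: measurable_sqnorm_mulmx.
have q0 : 0 < 1 + s ^- 2 by rewrite addr_gt0// invr_gt0 exprn_gt0.
rewrite mgf_sqnorm_mulmx lv//.
have e : expR (1 / 2) ^+ m = expR (m%:R / 2) :> R.
  by rewrite -expRM_natr; congr expR; lra.
rewrite -EFinM lee_fin exprMn e.
rewrite ler_pM2r ?expR_gt0// lerXn2r ?nnegrE ?invr_ge0 ?sqrtr_ge0 ?(ltW s0)//.
rewrite -[leRHS]invrK lef_pV2 ?posrE ?invr_gt0 ?sqrtr_gt0//.
rewrite -[leLHS]ger0_norm ?invr_ge0 ?(ltW s0)// -sqrtr_sqr ler_wsqrtr//.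
by rewrite exprVn lerDr.
Qed.

Let measurable_noise_neq0 i : measurable (z i @^-1` [set~ 0]).
Proof.
rewrite -[X in measurable X]setTI; apply: (mX (inr i)) => //.
exact: measurableC.
Qed.

Lemma probability_noise_neq0 : sigma = 0 ->
  P [set w | exists i, (z i @^-1` [set~ 0]) w] = 0%E.
Proof.
move=> s0; apply/eqP; rewrite eq_le measure_ge0 andbT.
apply: le_trans (probability_exists_le P measurable_noise_neq0) _.
rewrite big1// => i _; rewrite (law_z i).2//; last exact: measurableC.
by rewrite /gauss_law s0 eqxx diracE memNset//=; apply.
Qed.

(** Dividing by [|A v|] makes the threshold deterministic; given [A], the normalised product is
    Gaussian with standard deviation [sigma], or zero if [A v = 0]. *)
Lemma dot_mulmx_tail (v : 'cV[R]_n) (t : R) : 0 <= t ->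
  (P [set w | (sigma * t * norm2 (A w *m v) < dot (zv w) (A w *m v))%R] <=
   (expR (- (t ^+ 2 / 2)))%:E)%E.
Proof.
move=> t0.
set E := [set w | _].
have mE : measurable E.
  rewrite -[X in measurable X]setTI.
  apply: (measurable_fun_ltr _ (measurable_dot_mulmx v)) => //.
  by apply: measurable_funM => //; exact: measurable_norm2_mulmx.
(* If [sigma = 0], the event forces some noise entry to be nonzero, which has probability zero. *)
have [sig0|sig0] := eqVneq sigma 0.
  suff -> : P E = 0%E by rewrite lee_fin expR_ge0.
  apply/eqP; rewrite eq_le measure_ge0 andbT -(probability_noise_neq0 sig0).
  apply: le_measure; rewrite ?inE//; first exact: measurable_exists.
  move=> w /=; rewrite /E/= sig0 !mul0r => h; apply/not_existsP => z0.
  move: h; rewrite /dot big1 ?ltxx// => i _; rewrite mxE.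
  by have /contrapT -> := z0 i; rewrite mul0r.
have {}sig0 : 0 < sigma by rewrite lt_neqAle eq_sym sig0.
pose ks : seq (('I_m * 'I_n) + 'I_m) := [seq inr i | i <- enum 'I_m].
pose J : {set ('I_m * 'I_n) + 'I_m} := 
  finset (fun k => if k is inl _ then true else false).
(* The optimal Chernoff parameter: on the event the tilted sum is at least [tau sigma t = t^2], and
   [sigma^2 tau^2 / 2 - t^2 = - t^2 / 2]. *)
have [tau tauE] : {tau | tau = t / sigma} by exists (t / sigma).
pose b (k : ('I_m * 'I_n) + 'I_m) (w : T) : R :=
  match k with inl _ => 0
  | inr i => tau * (A w *m v) i ord0 / norm2 (A w *m v) end.
have mJ i : measurable_fun (setT : set (sigma_of X J))
    (fun w => (A w *m v) i ord0).
  under eq_fun do rewrite mulmx_entryE.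
  apply: measurable_sum => j; apply: measurable_funM => //.
  by apply: (sigma_of_measurable_fun (X := X) (i := inl (i, j))); rewrite inE.
have mJn : measurable_fun (setT : set (sigma_of X J))
    (fun w => norm2 (A w *m v)).
  apply: measurableT_comp.
    by apply: continuous_measurable_fun; exact: sqrt_continuous.
  by apply: measurable_sum => i; apply: measurable_funX; exact: mJ.
have mb k : measurable_fun (setT : set (sigma_of X J)) (b k).
  case: k => [p|i] /=; first exact: measurable_cst.
  apply: measurable_funM; first exact: measurable_funM.
  (* A real power is measurable on the whole line, and it agrees with the inverse at [0] too. *)
  rewrite (_ : (fun w => _) = (fun w => norm2 (A w *m v) `^ (-1))).
    exact: (measurableT_comp (measurable_powR (-1)) mJn).
  by apply/funext => w; rewrite powR_inv1// sqrtr_ge0.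
pose g w := \sum_(k <- ks) b k w * X k w - t ^+ 2.
have mg : measurable_fun setT g.
  apply: measurable_funB => //; apply: measurable_sum => k.
  by apply: measurable_funM => //; exact: (sigma_of_measurable_funT mX (mb k)).
have bX w : \sum_(k <- ks) b k w * X k w =
    tau * (dot (zv w) (A w *m v) / norm2 (A w *m v)).
  rewrite /ks big_map big_enum/= /dot mulr_suml mulr_sumr.
  apply: eq_bigr => i _; rewrite [zv w i ord0]mxE.
  by rewrite -!mulrA; congr (_ * _); rewrite mulrA mulrC.
(* Equality holds unless [A v = 0], where division by zero makes every coefficient vanish. *)
have b2 w : \sum_(k <- ks) b k w ^+ 2 <= tau ^+ 2.
  rewrite /ks big_map big_enum/=.
  have -> : \sum_(i < m) (tau * (A w *m v) i ord0 / norm2 (A w *m v)) ^+ 2 =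
     tau ^+ 2 * (sqnorm (A w *m v) / norm2 (A w *m v) ^+ 2).
    by rewrite mulr_suml mulr_sumr; apply: eq_bigr => i _; rewrite !exprMn exprVn mulrA.
  rewrite ler_piMr ?sqr_ge0// norm2_sqr.
  by have [->|?] := eqVneq (sqnorm (A w *m v)) 0; [rewrite mul0r|rewrite divff].
apply: le_trans (probability_le_integral_expR P mE mg _) _.
  move=> w; rewrite /E /g /= bX subr_ge0 => h.
  have n0 : 0 < norm2 (A w *m v).
    rewrite lt_neqAle sqrtr_ge0 andbT eq_sym; apply/eqP => n0.
    move: h; rewrite n0 mulr0 /dot big1 ?ltxx// => i _.
    by rewrite (@sqnorm_eq0 _ _ (A w *m v)) ?mulr0// -norm2_sqr n0 expr0n.
  have -> : t ^+ 2 = tau * (sigma * t).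
    by rewrite tauE; field; rewrite gt_eqF.
  by rewrite ler_wpM2l ?tauE ?divr_ge0// ler_pdivlMr// ltW.
rewrite /g; under eq_integral do rewrite expRD EFinM.
rewrite ge0_integralZr//; last first.
  apply/measurable_EFinP; apply: measurableT_comp; first exact: measurable_expR.
  apply: measurable_sum => k.
  by apply: measurable_funM => //; exact: (sigma_of_measurable_funT mX (mb k)).
under eq_integral do rewrite -[expR _]mul1r.
rewrite (integral_exp_sum_expM mX indep (J := J) (s := sigma))//; first last.
- by move=> k /mapP[i _ ->]; exact: law_z.
- by move=> k /mapP[i _ ->]; rewrite inE.
- by rewrite map_inj_uniq ?enum_uniq// => x y [].
apply: (@le_trans _ _ (\int[P]_w (expR (sigma ^+ 2 / 2 * tau ^+ 2))%:E *
    (expR (- t ^+ 2))%:E)%E).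
  rewrite lee_wpmul2r ?lee_fin ?expR_ge0//.
  apply: ge0_le_integral => //.
  - apply/measurable_EFinP; apply: measurable_funM => //.
    apply: measurableT_comp; first exact: measurable_expR.
    apply: measurable_funM => //; apply: measurable_sum => k.
    by apply: measurable_funX; exact: (sigma_of_measurable_funT mX (mb k)).
  - move=> w _; rewrite lee_fin mul1r ler_expR ler_wpM2l// divr_ge0// sqr_ge0//.
rewrite integral_cst// [X in (_ * X * _)%E](_ : _ = 1%E); last exact: probability_setT.
rewrite mule1 -EFinM lee_fin -expRD ler_expR.
rewrite le_eqVlt; apply/orP; left; apply/eqP.
by rewrite tauE; field; rewrite gt_eqF.
Qed.

End gaussian_matrix.

(** * The deterministic error bound *)

Lemma recovery_quadratic (R : rcfType) (x x0 k sigma delta beta : R) :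
  0 <= x -> 0 <= x0 -> 0 <= k -> 0 <= sigma -> 0 <= delta -> 0 <= beta ->
  x0 <= Num.sqrt 2 * delta ->
  x ^+ 2 <= x0 ^+ 2 + 2 * (sigma * (Num.sqrt 2 * k) * x0) +
            2 * (sigma * (Num.sqrt 2 * (k * beta)) * x) ->
  x <= 2 * sigma * beta * k +
       Num.sqrt (4 * sigma ^+ 2 * beta ^+ 2 * k ^+ 2 + 2 * delta ^+ 2
                 + 4 * sigma * delta * k).
Proof.
move=> x_ge0 x0_ge0 k_ge0 sigma_ge0 delta_ge0 beta_ge0 x0_le hx.
set q := Num.sqrt 2 in x0_le hx.
have q_ge0 : 0 <= q by exact: sqrtr_ge0.
have q2 : q ^+ 2 = 2 by rewrite sqr_sqrtr.
have q_le2 : q <= 2 by rewrite -(ler_pXn2r (n := 2)) ?nnegrE// q2 expr2; lra.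
(* Rounding [sqrt 2] up to [2] in the term linear in [x] bounds that term by [2 b x]. Completing the
   square then gives [(x - b)^2 <= b^2 + 2 delta^2 + 4 sigma delta k]. *)
pose b := 2 * sigma * beta * k.
have b_ge0 : 0 <= b by rewrite !mulr_ge0.
have h1 : x0 ^+ 2 <= 2 * delta ^+ 2.
  by rewrite -q2 -exprMn lerXn2r ?nnegrE ?mulr_ge0.
have h2 : sigma * (q * k) * x0 <= 2 * sigma * delta * k.
  have -> : 2 * sigma * delta * k = sigma * (q * k) * (q * delta) by rewrite -q2; ring.
  by rewrite ler_wpM2l// !mulr_ge0.
have h3 : sigma * (q * (k * beta)) * x <= b * x.
  rewrite ler_wpM2r//.
  have -> : b = 2 * (sigma * (k * beta)) by rewrite /b; ring.
  have -> : sigma * (q * (k * beta)) = q * (sigma * (k * beta)) by ring.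
  by rewrite ler_wpM2r// !mulr_ge0.
rewrite -lerBlDl -/b; apply: le_trans (ler_norm _) _.
rewrite -sqrtr_sqr ler_wsqrtr//.
have -> : 4 * sigma ^+ 2 * beta ^+ 2 * k ^+ 2 = b ^+ 2 by rewrite /b; ring.
have -> : (x - b) ^+ 2 = x ^+ 2 - 2 * (b * x) + b ^+ 2 by ring.
lra.
Qed.

Section expansion.
Context {R : realType} {m : nat}.
Implicit Types u v : 'cV[R]_m.

Lemma dotN u v : dot u (- v) = - dot u v.
Proof.
by rewrite /dot -sumrN; apply: eq_bigr => i _; rewrite mxE mulrN.
Qed.

Lemma sqnormN v : sqnorm (- v) = sqnorm v.
Proof. by apply: eq_bigr => i _; rewrite mxE sqrrN. Qed.

Lemma norm2N v : norm2 (- v) = norm2 v.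
Proof. by congr Num.sqrt; exact: sqnormN. Qed.

Lemma sqnormB u v : sqnorm (u - v) = sqnorm u - 2 * dot u v + sqnorm v.
Proof.
rewrite /sqnorm /dot mulr_sumr -sumrB -big_split/=.
by apply: eq_bigr => i _; rewrite !mxE; ring.
Qed.

Lemma norm2_ge0 v : 0 <= norm2 v.
Proof. exact: sqrtr_ge0. Qed.

End expansion.

(** Everything is divided by [N = sqrt m]. Since [r / L = m / eta], the noise thresholds become
    [sqrt 2 k] and [sqrt 2 k sqrt L] with [k = 1 / sqrt eta]. The quadratic bound controls [W / N],
    which dominates [s |c - xo|]. *)
Lemma recovery_error (R : realType) (m n : nat) (A : 'M[R]_(m, n))
    (z : 'cV[R]_m) (xo c c0 : 'cV[R]_n) (sigma delta eta L r s : R) :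
  (0 < m)%N -> 0 < eta -> 0 < L -> 0 <= sigma -> 0 <= delta -> 0 < s ->
  m%:R = eta * r / L ->
  norm2 (A *m xo + z - A *m c) ^+ 2 <= norm2 (A *m xo + z - A *m c0) ^+ 2 ->
  sqnorm (A *m (xo - c0)) <= 2 * m%:R * delta ^+ 2 ->
  dot z (A *m (xo - c0)) <=
    sigma * Num.sqrt (2 * (r / L)) * norm2 (A *m (xo - c0)) ->
  dot z (A *m (c - xo)) <= sigma * Num.sqrt (2 * r) * norm2 (A *m (c - xo)) ->
  s ^+ 2 * m%:R * sqnorm (c - xo) <= sqnorm (A *m (c - xo)) ->
  norm2 (c - xo) <= s^-1 *
    (2 * sigma * Num.sqrt L / Num.sqrt eta +
     Num.sqrt (4 * sigma ^+ 2 * Num.sqrt L ^+ 2 / eta + 2 * delta ^+ 2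
               + 4 * sigma * delta / Num.sqrt eta)).
Proof.
move=> m_gt0 eta_gt0 L_gt0 sigma_ge0 delta_ge0 s_gt0 mE hmin hA0 hz0 hz hA.
have M0 : 0 < m%:R :> R by rewrite ltr0n.
set k := (Num.sqrt eta)^-1.
have k_ge0 : 0 <= k by rewrite invr_ge0 sqrtr_ge0.
have k2 : k ^+ 2 = eta^-1 by rewrite exprVn sqr_sqrtr// ltW.
set N := Num.sqrt m%:R : R.
have N_gt0 : 0 < N by rewrite sqrtr_gt0.
have N2 : N ^+ 2 = m%:R by rewrite sqr_sqrtr// ltW.
have rE : r = m%:R * eta^-1 * L by rewrite mE; field; rewrite !gt_eqF.
have t0E : Num.sqrt (2 * (r / L)) = N * (Num.sqrt 2 * k).
  have -> : 2 * (r / L) = m%:R * (2 * eta^-1) by rewrite rE; field; rewrite !gt_eqF.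
  by rewrite sqrtrM ?(ltW M0)// sqrtrM// sqrtrV// ltW.
have t1E : Num.sqrt (2 * r) = N * (Num.sqrt 2 * (k * Num.sqrt L)).
  have -> : 2 * r = m%:R * (2 * (eta^-1 * L)) by rewrite rE; ring.
  by rewrite sqrtrM ?(ltW M0)// sqrtrM// sqrtrM ?invr_ge0 ?(ltW eta_gt0)// sqrtrV// ltW.
set W := norm2 (A *m (c - xo)) in hz *.
set W0 := norm2 (A *m (xo - c0)) in hz0 *.
have W2 : W ^+ 2 = sqnorm (A *m (c - xo)) by exact: norm2_sqr.
have W02 : W0 ^+ 2 = sqnorm (A *m (xo - c0)) by exact: norm2_sqr.
have W_ge0 : 0 <= W by exact: norm2_ge0.
have W0_ge0 : 0 <= W0 by exact: norm2_ge0.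
(* In this form the term [|z|^2] cancels when the two residuals are compared. *)
have resE x : A *m xo + z - A *m x = z - A *m (x - xo).
  by rewrite mulmxBr opprB [LHS]addrAC addrC.
have hW : W ^+ 2 <= W0 ^+ 2 + 2 * (sigma * Num.sqrt (2 * (r / L)) * W0) +
    2 * (sigma * Num.sqrt (2 * r) * W).
  move: hmin; rewrite !resE !norm2_sqr !sqnormB -W2.
  rewrite -[c0 - xo]opprB mulmxN sqnormN dotN -W02.
  lra.
set D := norm2 (c - xo).
have D_ge0 : 0 <= D by exact: norm2_ge0.
have sD : s * D <= W / N.
  rewrite ler_pdivlMr// -(ler_pXn2r (n := 2)) ?nnegrE ?mulr_ge0 ?(ltW s_gt0) ?(ltW N_gt0)//.
  by rewrite W2 !exprMn N2 /D norm2_sqr mulrAC.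
rewrite -ler_pdivrMl ?invr_gt0// invrK; apply: le_trans sD _.
have key := @recovery_quadratic R (W / N) (W0 / N) k sigma delta (Num.sqrt L).
rewrite -k2; apply: key => //; rewrite ?divr_ge0 ?sqrtr_ge0 ?(ltW N_gt0)//.
- rewrite ler_pdivrMr// -(ler_pXn2r (n := 2)) ?nnegrE ?mulr_ge0 ?sqrtr_ge0//.
  by rewrite W02 !exprMn sqr_sqrtr// N2 mulrAC.
- rewrite -(ler_pM2r (exprn_gt0 2 N_gt0)).
  have N0 : N != 0 by rewrite gt_eqF.
  have -> : (W / N) ^+ 2 * N ^+ 2 = W ^+ 2 by field.
  apply: le_trans hW _; rewrite t0E t1E le_eqVlt; apply/orP; left; apply/eqP.
  by field.
Qed.

(** * Numerical cost of the union bounds, and the distortion bound *)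

Lemma natrX2_expR (R : realType) (r : nat) : (2 ^ r)%:R = expR (r%:R * ln 2) :> R.
Proof. by rewrite mulrC expRM_natr lnK ?posrE// natrX. Qed.

(** The left side is [exp (r ln 2 - r)], and [ln 2 <= 0.7]. *)
Lemma union_noise_le (R : realType) (r : nat) :
  (2 ^ r)%:R * expR (- (Num.sqrt (2 * r%:R) ^+ 2 / 2)) <=
  expR (- (3 / 10 * r%:R)) :> R.
Proof.
rewrite natrX2_expR sqr_sqrtr ?mulr_ge0// -expRD ler_expR.
have := ler_wpM2l (ler0n R r) (ln2_le R); lra.
Qed.

(** Since [m l = eta r ln 2], the [m]-th power of the first exponential is [2^(- (1 + eps) r)]. This
    leaves [2^(- eps r) exp (m / 2)] with [m <= eps r ln 2], hence at most [exp (- eps r ln 2 / 2)];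
    finally [ln 2 >= 0.6]. *)
Lemma union_lower_tail_le (R : realType) (r m : nat) (eta eps l : R) :
  0 < eta -> 0 < l -> 0 <= eps -> m%:R = eta * r%:R / (l / ln 2) ->
  eta / l <= eps ->
  (2 ^ r)%:R * (expR (- ((1 + eps) / eta * l)) * expR (1 / 2)) ^+ m <=
  expR (- (3 / 10 * eps * r%:R)).
Proof.
move=> eta0 l0 eps0 mE etal.
have ln20 : 0 < ln 2 :> R by apply: lt_le_trans (ln2_ge R).
have m_l : m%:R * l = eta * r%:R * ln 2.
  by rewrite mE; field; rewrite !gt_eqF.
have m_le : m%:R <= eps * (r%:R * ln 2).
  have -> : m%:R = eta / l * (r%:R * ln 2) by rewrite mE; field; rewrite !gt_eqF.
  by rewrite ler_wpM2r// mulr_ge0// ltW.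
rewrite natrX2_expR -!expRD -expRM_natr -expRD ler_expR.
have -> : (- ((1 + eps) / eta * l) + 1 / 2) * m%:R =
    - ((1 + eps) / eta * (m%:R * l)) + m%:R / 2 by ring.
rewrite m_l.
have -> : (1 + eps) / eta * (eta * r%:R * ln 2) = (1 + eps) * (r%:R * ln 2).
  by field; rewrite gt_eqF.
have : (eps * r%:R) * (3 / 5) <= (eps * r%:R) * ln 2.
  by rewrite ler_wpM2l ?mulr_ge0// ln2_ge.
lra.
Qed.

Lemma distortion_ge (R : realType) (n r : nat) (Q : set 'cV[R]_n)
    (Enc : 'cV[R]_n -> 'I_(2 ^ r)) (Dec : 'I_(2 ^ r) -> 'cV[R]_n) x :
  0 < distortion Q Enc Dec -> Q x ->
  norm2 (x - Dec (Enc x)) <= distortion Q Enc Dec.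
Proof.
move=> d0 Qx; rewrite /distortion; apply: ub_le_sup; last by exists x.
(* [sup] of an unbounded set is 0, so positivity gives boundedness *)
have [[]//|/sup_out] := pselect (has_sup [set norm2 (x - Dec (Enc x)) | x in Q]).
by move=> d1; move: d0; rewrite /distortion d1 ltxx.
Qed.

(** * Measurability of the recovery event *)

Lemma measurable_imply_cst {d : measure_display} {T : measurableType d}
    (A : set T) (B : Prop) :
  measurable A -> measurable [set w | A w -> B].
Proof.
move=> mA; have [b|nb] := pselect B.
  rewrite (_ : [set w | _] = setT); first exact: measurableT.
  by apply/seteqP; split => [w|w _ _] .
rewrite (_ : [set w | _] = ~` A); first exact: measurableC.
apply/seteqP; split => w h; first by move=> Aw; exact/nb/h.
by move=> Aw; have := h Aw.
Qed.

Lemma measurable_cst_imply {d : measure_display} {T : measurableType d}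
    (A : set T) (B : Prop) :
  measurable A -> measurable [set w | B -> A w].
Proof.
move=> mA; have [b|nb] := pselect B.
    rewrite (_ : [set w | _] = A)//.
  by apply/seteqP; split => w //= /(_ b).
rewrite (_ : [set w | _] = setT); first exact: measurableT.
by apply/seteqP; split => [w|w _ /nb].
Qed.

Lemma measurable_forall {d : measure_display} {T : measurableType d}
    (K : finType) (A : K -> set T) :
  (forall k, measurable (A k)) -> measurable [set w | forall k, A k w].
Proof.
move=> mA; rewrite (_ : [set w | _] = \bigcap_(k in [set: K]) A k).
  exact: fin_bigcap_measurable.
by apply/seteqP; split => w /= h k => [_|]; exact: h.
Qed.

(** Candidates lie in the range of [D] on a finite type, so the event is a finite Boolean
    combination of comparisons between measurable residuals; membership in [C] and the property [B]
    do not vary with [w]. *)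
Lemma measurable_argmin {R : realType} {d : measure_display}
    {T : measurableType d} {K : finType} {m n : nat} (C : set 'cV[R]_n)
    (D : K -> 'cV[R]_n) (A : T -> 'M[R]_(m, n)) (y : T -> 'cV[R]_m)
    (B : 'cV[R]_n -> Prop) :
  C `<=` range D ->
  (forall c, measurable_fun setT (fun w => sqnorm (y w - A w *m c))) ->
  measurable [set w | forall c, argmin_set C (A w) (y w) c -> B c].
Proof.
move=> CD mf.
rewrite (_ : [set w | _] = [set w | forall k,
  [set w | [set w | C (D k) -> forall k', [set w | C (D k') ->
    [set w | sqnorm (y w - A w *m D k) <= sqnorm (y w - A w *m D k')] w] w] w
  -> C (D k) -> B (D k)] w]); last first.
  apply/seteqP; split => w /= h.
    move=> k hk Ck; apply: h; split => // c' Cc'.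
    have [k' _ k'E] := CD _ Cc'; rewrite !norm2_sqr -k'E; apply: hk => //.
    by rewrite k'E.
  move=> c [Cc hc]; have [k _ kE] := CD _ Cc.
  rewrite -kE; apply: h; last by rewrite kE.
  by move=> _ k' Ck'; rewrite -!norm2_sqr kE; exact: hc.
apply: measurable_forall => k; apply: measurable_imply_cst.
apply: measurable_cst_imply; apply: measurable_forall => k'.
apply: measurable_cst_imply.
rewrite -[X in measurable X]setTI.
exact: (measurable_fun_ler (mf _) (mf _)).
Qed.

Lemma probability_gt_of_cover {R : realType} {d : measure_display}
    {T : measurableType d} (P : probability T R) (S E : set T) (e b : R) :
  measurable S -> measurable E -> ~` S `<=` E -> (P E <= e%:E)%E ->
  b < 1 - e -> (b%:E < P S)%E.
Proof.
move=> mS mE SE Ee be.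
have : (P (~` S) <= e%:E)%E.
  apply: le_trans Ee; apply: le_measure => //; rewrite inE//.
  exact: measurableC.
rewrite probability_setC// => h.
have PS : P S \is a fin_num by exact: fin_num_measure.
rewrite -(fineK PS) lte_fin; move: h; rewrite -(fineK PS) -EFinB lee_fin.
lra.
Qed.

(** * The recovery guarantee *)

Unset Implicit Arguments.

Theorem theorem4 (R : realType) (n r dd : nat) (Q : set 'cV[R]_n)
  (Enc : 'cV[R]_n -> 'I_(2 ^ r)) (Dec : 'I_(2 ^ r) -> 'cV[R]_n)
  (delta eta eps' sigma : R)
  (dsp : measure_display) (T : measurableType dsp) (P : probability T R)
  (Aent : 'I_dd -> 'I_n -> T -> R) (z : 'I_dd -> T -> R) :
  compact Q ->
  delta = distortion Q Enc Dec ->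
  0 < delta ->
  1 < eta ->
  (dd%:R : R) = eta * r%:R / log2 (1 / (expR 1 * delta)) ->
  0 < eps' ->
  eta / ln (1 / (expR 1 * delta)) <= eps' ->
  0 <= sigma ->
  (forall i j, has_gauss_law P 1 (Aent i j)) ->
  (forall i, has_gauss_law P sigma (z i)) ->
  mutually_independent P
    (fun k : ('I_dd * 'I_n) + 'I_dd =>
       match k with inl (i, j) => Aent i j | inr i => z i end) ->
  let beta := Num.sqrt (log2 (1 / (expR 1 * delta))) in
  let L := log2 (1 / (expR 1 * delta)) in
  let C := codebook Q Enc Dec in
  let A := fun w : T => \matrix_(i < dd, j < n) Aent i j w in
  let zv := fun w : T => \col_(i < dd) z i w in
  forall xo : 'cV[R]_n, Q xo ->
  let y := fun w : T => A w *m xo + zv w in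
  let bound :=
    (1 / ((expR 1 * delta) `^ ((1 + eps') / eta))) *
    (2 * sigma * beta / Num.sqrt eta +
     Num.sqrt (4 * sigma ^+ 2 * beta ^+ 2 / eta + 2 * delta ^+ 2
               + 4 * sigma * delta / Num.sqrt eta)) in
  (P [set w | forall c, argmin_set C (A w) (y w) c -> (norm2 (c - xo) <= bound)%R]
   > (1 - 2 * expR (- (15 / 100 * eta * r%:R / L)) - expR (- (r%:R / L))
        - expR (- (3 / 10 * r%:R)) - expR (- (3 / 10 * eps' * r%:R)))%:E)%E.
Proof.
move=> _ deltaE delta_gt0 eta_gt1 ddE eps_gt0 eps_ge sigma_ge0 law_a law_z indep.
move=> beta L C A zv xo Qxo.
set y := fun w : T => A w *m xo + zv w.
cbv zeta; set bound := _ * (_ + _).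
have eta_gt0 : 0 < eta by exact: lt_trans eta_gt1.
pose l := ln (1 / (expR 1 * delta)).
have ln2_gt0 : 0 < ln 2 :> R by apply: lt_le_trans (ln2_ge R).
have [L_le0|L_gt0] := leP L 0.
  (* the guarantee is void: [L < 0] forces [r = 0], and [r / 0 = 0] *)
  have rLE : r%:R / L = dd%:R / eta.
    by rewrite ddE -/L [RHS]mulrC !mulrA mulVf ?gt_eqF// mul1r.
  have rL0 : r%:R / L = 0.
    apply/eqP; rewrite eq_le mulr_ge0_le0 ?invr_le0//=.
    by rewrite rLE divr_ge0// ltW.
  apply: lt_le_trans (measure_ge0 _ _); rewrite lte_fin.
  have -> : 15 / 100 * eta * r%:R / L = 0 by rewrite -mulrA rL0 mulr0.
  rewrite rL0 oppr0 expR0.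
  have := expR_gt0 (- (3 / 10 * r%:R) : R).
  have := expR_gt0 (- (3 / 10 * eps' * r%:R) : R).
  lra.
(* At rate zero every exponential equals [1], so the claimed lower bound is negative. *)
have [r0|r_gt0] := posnP r.
  apply: lt_le_trans (measure_ge0 _ _); rewrite lte_fin.
  rewrite r0 !(mulr0, mul0r) oppr0 expR0; lra.
have l_gt0 : 0 < l by move: L_gt0; rewrite /L /log2 pmulr_lgt0// invr_gt0.
have r0R : 0 < r%:R :> R by rewrite ltr0n.
have dd_gt0 : (0 < dd)%N.
  by rewrite -(ltr0n R) ddE divr_gt0// mulr_gt0.
(* This is [(e delta)^((1 + eps') / eta)], whose inverse is the prefactor of the bound. *)
pose s := expR (- ((1 + eps') / eta * l)).
have sE : 1 / ((expR 1 * delta) `^ ((1 + eps') / eta)) = s^-1.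
  have u_gt0 : 0 < expR 1 * delta by rewrite mulr_gt0 ?expR_gt0.
  by rewrite !div1r /s /l /powR gt_eqF// div1r lnV ?posrE// mulrN opprK.
pose c0 := Dec (Enc xo).
have Cc0 : C c0 by exists xo.
pose E1 := [set w | 2 * dd%:R * delta ^+ 2 < sqnorm (A w *m (xo - c0))].
pose E2 := [set w | sigma * Num.sqrt (2 * (r%:R / L)) *
  norm2 (A w *m (xo - c0)) < dot (zv w) (A w *m (xo - c0))].
(* The minimiser depends on [w], so [E3] and [E4] range over all decoder outputs; [E1] and [E2]
   concern only the fixed codeword [c0]. *)
pose E3 := [set w | exists k, [set w | sigma * Num.sqrt (2 * r%:R) *
  norm2 (A w *m (Dec k - xo)) < dot (zv w) (A w *m (Dec k - xo))] w].
pose E4 := [set w | exists k, [set w | sqnorm (A w *m (Dec k - xo)) <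
  s ^+ 2 * dd%:R * sqnorm (Dec k - xo)] w].
pose e1 : R := expR (- (15 / 100 * dd%:R)).
pose e2 : R := expR (- (r%:R / L)).
pose e3 : R := expR (- (3 / 10 * r%:R)).
pose e4 : R := expR (- (3 / 10 * eps' * r%:R)).
have mA v := measurable_sqnorm_mulmx law_a law_z v.
have mN v := measurable_norm2_mulmx law_a law_z v.
have mD v := measurable_dot_mulmx law_a law_z v.
have mlow v : measurable [set w | sqnorm (A w *m v) < s ^+ 2 * dd%:R * sqnorm v].
  rewrite -[X in measurable X]setTI.
  exact: (measurable_fun_ltr (mA v) (measurable_cst _)).
have mcross v t : measurable [set w |
    sigma * t * norm2 (A w *m v) < dot (zv w) (A w *m v)].
  rewrite -[X in measurable X]setTI.
  apply: (measurable_fun_ltr _ (mD v)) => //.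
  by apply: measurable_funM => //; exact: mN.
have mE1 : measurable E1.
  rewrite -[X in measurable X]setTI.
  exact: (measurable_fun_ltr (measurable_cst _) (mA _)).
have mE2 : measurable E2 by exact: mcross.
have mE3 : measurable E3 by apply: measurable_exists => k; exact: mcross.
have mE4 : measurable E4 by apply: measurable_exists => k; exact: mlow.
have PE1 : (P E1 <= e1%:E)%E.
  apply: (sqnorm_mulmx_upper_tail law_a law_z indep) => //.
  rewrite -norm2_sqr lerXn2r ?nnegrE ?norm2_ge0 ?(ltW delta_gt0)//.
  by rewrite deltaE distortion_ge// -deltaE.
have PE2 : (P E2 <= e2%:E)%E.
  have := dot_mulmx_tail sigma_ge0 law_a law_z indep (xo - c0)
    (sqrtr_ge0 (2 * (r%:R / L))).
  rewrite sqr_sqrtr; last by rewrite mulr_ge0// divr_ge0// ltW.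
  by rewrite [2 * _ / 2]mulrAC divff// mul1r.
have Punion (E : 'I_(2 ^ r) -> set T) (e f : R) :
    (forall k, measurable (E k)) -> (forall k, P (E k) <= e%:E)%E ->
    (2 ^ r)%:R * e <= f -> (P [set w | exists k, E k w] <= f%:E)%E.
  move=> mE PE ef; apply: le_trans (probability_exists_le P mE) _.
  apply: (@le_trans _ _ (\sum_(k < 2 ^ r) e%:E)%E).
    by apply: lee_sum => k _.
  by rewrite sumEFin lee_fin sumr_const card_ord -mulr_natl.
have PE3 : (P E3 <= e3%:E)%E.
  apply: Punion (union_noise_le R r) => k; first exact: mcross.
  exact: dot_mulmx_tail sigma_ge0 law_a law_z indep _ _ (sqrtr_ge0 _).
have PE4 : (P E4 <= e4%:E)%E.
  apply: Punion (union_lower_tail_le eta_gt0 l_gt0 (ltW eps_gt0) ddE eps_ge) => k.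
    exact: mlow.
  exact: (sqnorm_mulmx_lower_tail law_a law_z indep (Dec k - xo) (s := s)
    (expR_gt0 _)).
pose E := E1 `|` E2 `|` E3 `|` E4.
have mE : measurable E by do 3!apply: measurableU => //.
have PE : (P E <= (e1 + e2 + e3 + e4)%:E)%E.
  rewrite !EFinD.
  do 3!(apply: le_trans (measureU2 _ _ _) _; rewrite ?leeD//;
    try by repeat apply: measurableU).
apply: (probability_gt_of_cover (E := E) _ mE _ PE); last first.
- have -> : 15 / 100 * eta * r%:R / L = 15 / 100 * dd%:R.
    by rewrite ddE -/L !mulrA.
  (* The four events cost [e1] only once; the second copy in the claim provides the strict
     inequality. *)
  have := expR_gt0 (- (15 / 100 * dd%:R) : R).
  rewrite -/e1 -/e2 -/e3 -/e4; lra.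
(* Outside the four events all hypotheses of [recovery_error] hold at [w], for every minimiser. *)
- move=> w nS; apply: contrapT => nE; apply: nS => c [[x Qx <-] hc].
  have h1 : sqnorm (A w *m (xo - c0)) <= 2 * dd%:R * delta ^+ 2.
    by rewrite leNgt; apply/negP => h; apply: nE; do 3!left.
  have h2 : dot (zv w) (A w *m (xo - c0)) <=
      sigma * Num.sqrt (2 * (r%:R / L)) * norm2 (A w *m (xo - c0)).
    by rewrite leNgt; apply/negP => h; apply: nE; do 2!left; right.
  have h3 k : dot (zv w) (A w *m (Dec k - xo)) <=
      sigma * Num.sqrt (2 * r%:R) * norm2 (A w *m (Dec k - xo)).
    by rewrite leNgt; apply/negP => h; apply: nE; left; right; exists k.
  have h4 k : s ^+ 2 * dd%:R * sqnorm (Dec k - xo) <=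
      sqnorm (A w *m (Dec k - xo)).
    by rewrite leNgt; apply/negP => h; apply: nE; right; exists k.
  rewrite /bound sE; apply: (recovery_error dd_gt0 eta_gt0 L_gt0 sigma_ge0
    (ltW delta_gt0) (expR_gt0 _) ddE (hc _ Cc0) h1 h2 (h3 _) (h4 _)).
- apply: (measurable_argmin (D := Dec)).
    by move=> _ [x _ <-]; exists (Enc x).
  move=> c; apply: measurable_sum => i; apply: measurable_funX.
  rewrite (_ : (fun w => _) = (fun w => (A w *m xo) i ord0 + z i w -
      (A w *m c) i ord0)); last by apply/funext => w; rewrite !mxE.
  apply: measurable_funB; last exact: (measurable_mulmx_entry law_a law_z).
  apply: measurable_funD; first exact: (measurable_mulmx_entry law_a law_z).
  by case: (law_z i).
Qed.
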